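(* Let $m\ge 1$ and $M\ge 2$ be integers, and let $p_0^*,\dots,p_m^*\ge 0$ be fixed real numbers with $\sum_{i=0}^m p_i^*=1$. For a real matrix $\mathbf{P}=[p_{i,j}]_{0\le i\le m,\,0\le j\le M-1}$, with $\mathbf{p}^{\mathrm{con}}$ the vector obtained by concatenating its rows, let $f(X,Y)=\sum_{i=0}^m\sum_{j=0}^{M-1}p_{i,j}X^iY^j$ and $$P_6(\mathbf{p}^{\mathrm{con}})=\sum_{M\mid b}\left[f^3(X,Y)f^3(X^{-1},Y^{-1})\right]_{0,b}.$$ For $P_6(\mathbf{p}^{\mathrm{con}})$ to be locally minimized subject to the constraints $$p_{i,0}+p_{i,1}+\dots+p_{i,M-1}=p_i^*\quad\text{for all } i\in\{0,1,\dots,m\},$$ where each $p_{i,j}\in[0,1]$, it is necessary that there exist $c_0,\dots,c_m\in\mathbb{R}$ such that $$\sum_{M\mid b}\left[f^3(X,Y)f^2(X^{-1},Y^{-1})\right]_{i,b+j}=c_i$$ for all $i\in\{0,1,\dots,m\}$ and $j\in\{0,1,\dots,M-1\}$.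
   Context: $[\cdot]_{i,j}$ denotes the coefficient of $X^iY^j$ in a two-variable Laurent polynomial; $\sum_{M\mid b}$ is the sum over all integers $b$ (positive, negative or zero) divisible by $M$; $f^k(X,Y)$ means $(f(X,Y))^k$. The constant $c_i$ may depend on $i$ but not on $j$. *)

(* Defs.v *)
From HB Require Import structures.
From mathcomp Require Import all_boot all_order all_algebra finmap.
From mathcomp Require Import boolp classical_sets functions cardinality fsbigop.
From mathcomp Require Import reals topology normedtype.
Set Implicit Arguments.
Unset Strict Implicit.
Unset Printing Implicit Defensive.
Import Order.TTheory GRing.Theory Num.Theory.
Import numFieldNormedType.Exports.
Local Open Scope classical_set_scope.
Local Open Scope ring_scope.

(* Two-variable Laurent polynomials.  An element is its finitely supported
   family of coefficients: the value at (i, j) : int * int is the coefficient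
   of X^i Y^j.  [monalg.malg] is not usable here, since its [monomType] excludes
   monoids of exponents with nontrivial inverses. *)
Record laurent2 (R : comNzRingType) : predArgType :=
  Laurent2 { laurent2_val : {fsfun int * int -> R with 0} }.

HB.instance Definition _ (R : comNzRingType) :=
  [isNew for @laurent2_val R].
HB.instance Definition _ (R : comNzRingType) :=
  [Choice of laurent2 R by <:].

Bind Scope ring_scope with laurent2.

Section LaurentRing.
Local Open Scope fset_scope.
Local Open Scope ring_scope.
Variable R : comNzRingType.
Implicit Types (g h : laurent2 R) (k : int * int) (c : R).

Definition lcoef g k : R := laurent2_val g k.

Definition lsupp g : {fset int * int} := finsupp (laurent2_val g).

Definition lmono c k : laurent2 R :=
  Laurent2 [fsfun x in [fset k] => c].

Lemma laurentP g h : (forall k, lcoef g k = lcoef h k) <-> g = h.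
Proof.
by case: g h => [g] [h]; split=> [e|->//]; congr Laurent2; apply/fsfunP/e.
Qed.

Lemma lcoef_out g k : k \notin lsupp g -> lcoef g k = 0.
Proof. exact: fsfun_dflt. Qed.

Lemma lcoef_mono c k k' : lcoef (lmono c k) k' = if k' == k then c else 0.
Proof. by rewrite /lcoef fsfun_fun inE. Qed.

Lemma lsupp_mono c k : lsupp (lmono c k) `<=` [fset k].
Proof.
apply/fsubsetP => k'; rewrite mem_finsupp -/(lcoef (lmono c k) k') lcoef_mono.
by rewrite inE; case: ifP; rewrite ?eqxx.
Qed.

Definition lzero : laurent2 R := Laurent2 [fsfun].
Definition lopp g : laurent2 R :=
  Laurent2 [fsfun k in lsupp g => - lcoef g k].
Definition ladd g h : laurent2 R :=
  Laurent2 [fsfun k in lsupp g `|` lsupp h => lcoef g k + lcoef h k].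

Fact lcoef_zero k : lcoef lzero k = 0.
Proof. by rewrite /lcoef fsfun0E. Qed.

Fact lcoef_opp g k : lcoef (lopp g) k = - lcoef g k.
Proof.
by rewrite {1}/lcoef fsfun_fun; case: ifPn => // /lcoef_out ->; rewrite oppr0.
Qed.

Fact lcoef_add g h k : lcoef (ladd g h) k = lcoef g k + lcoef h k.
Proof.
rewrite {1}/lcoef fsfun_fun inE; case: ifPn => //.
by rewrite negb_or => /andP[/lcoef_out -> /lcoef_out ->]; rewrite addr0.
Qed.

Fact laddA : associative ladd.
Proof. by move=> x y z; apply/laurentP => k; rewrite !lcoef_add addrA. Qed.
Fact laddC : commutative ladd.
Proof. by move=> x y; apply/laurentP => k; rewrite !lcoef_add addrC. Qed.
Fact ladd0g : left_id lzero ladd.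
Proof. by move=> x; apply/laurentP => k; rewrite lcoef_add lcoef_zero add0r. Qed.
Fact laddNg : left_inverse lzero lopp ladd.
Proof.
by move=> x; apply/laurentP => k; rewrite lcoef_add lcoef_opp lcoef_zero addNr.
Qed.

HB.instance Definition _ :=
  GRing.isZmodule.Build (laurent2 R) laddA laddC ladd0g laddNg.

Lemma lcoef0 k : lcoef 0 k = 0. Proof. exact: lcoef_zero. Qed.
Lemma lcoefD g h k : lcoef (g + h) k = lcoef g k + lcoef h k.
Proof. exact: lcoef_add. Qed.
Lemma lcoefN g k : lcoef (- g) k = - lcoef g k.
Proof. exact: lcoef_opp. Qed.
Lemma lcoef_sum (I : Type) (r : seq I) (P : pred I) (F : I -> laurent2 R) k :
  lcoef (\sum_(i <- r | P i) F i) k = \sum_(i <- r | P i) lcoef (F i) k.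
Proof. exact: (big_morph (fun g => lcoef g k) (fun g h => lcoefD g h k) (lcoef0 k)). Qed.

Lemma lmono0 k : lmono 0 k = 0.
Proof. by apply/laurentP => k'; rewrite lcoef_mono lcoef0 if_same. Qed.

Lemma lmonoD c c' k : lmono (c + c') k = lmono c k + lmono c' k.
Proof.
by apply/laurentP => k'; rewrite lcoefD !lcoef_mono; case: ifP; rewrite ?addr0.
Qed.

Lemma laurentE g : g = \sum_(k <- lsupp g) lmono (lcoef g k) k.
Proof.
apply/laurentP => k; rewrite lcoef_sum.
under eq_bigr do rewrite lcoef_mono.
have [kg|kNg] := boolP (k \in lsupp g).
  rewrite (big_fsetD1 k) //= eqxx big1_fset ?addr0 // => k'.
  by rewrite !inE eq_sym => /andP[/negPf ->].
rewrite lcoef_out // big_seq big1 // => k' k'g.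
by case: eqP k'g kNg => // -> ->.
Qed.

Definition lone : laurent2 R := lmono 1 0.

Definition lmul g h : laurent2 R :=
  \sum_(k <- lsupp g) \sum_(l <- lsupp h) lmono (lcoef g k * lcoef h l) (k + l).

Fact lmulw (d1 d2 : {fset int * int}) g h :
  lsupp g `<=` d1 -> lsupp h `<=` d2 ->
  lmul g h = \sum_(k <- d1) \sum_(l <- d2) lmono (lcoef g k * lcoef h l) (k + l).
Proof.
move=> le1 le2; rewrite /lmul (big_fset_incl _ le1) /=; last first.
  by move=> k _ /lcoef_out ->; rewrite big1 // => l _; rewrite mul0r lmono0.
apply: eq_bigr => k _; apply: big_fset_incl => // l _ /lcoef_out ->.
by rewrite mulr0 lmono0.
Qed.

Fact lsuppD g h : lsupp (g + h) `<=` lsupp g `|` lsupp h.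
Proof.
apply/fsubsetP => k; apply: contraLR; rewrite inE negb_or => /andP[kg kh].
by rewrite memNfinsupp -/(lcoef (g + h) k) lcoefD !lcoef_out ?addr0.
Qed.

Fact lmulC : commutative lmul.
Proof.
move=> g h; rewrite /lmul exchange_big; apply: eq_bigr => k _.
by apply: eq_bigr => l _; rewrite mulrC addrC.
Qed.

Fact lmulDl : left_distributive lmul +%R.
Proof.
move=> g1 g2 h; rewrite [lmul g1 h](lmulw (fsubsetUl _ (lsupp g2)) (fsubset_refl _)).
rewrite [lmul g2 h](lmulw (fsubsetUr (lsupp g1) _) (fsubset_refl _)).
rewrite (lmulw (lsuppD _ _) (fsubset_refl _)) -big_split; apply: eq_bigr => k _.
rewrite -big_split; apply: eq_bigr => l _ /=.
by rewrite lcoefD mulrDl lmonoD.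
Qed.

Fact lmulDr : right_distributive lmul +%R.
Proof. by move=> g h1 h2; rewrite lmulC lmulDl ![lmul _ g]lmulC. Qed.

Fact lmul0g : left_zero 0 lmul.
Proof. by move=> g; apply: (@addrI _ (lmul 0 g)); rewrite -lmulDl !addr0. Qed.

Fact lmulg0 : right_zero 0 lmul.
Proof. by move=> g; rewrite lmulC lmul0g. Qed.

Fact lmulUU c c' k l : lmul (lmono c k) (lmono c' l) = lmono (c * c') (k + l).
Proof.
by rewrite (lmulw (lsupp_mono _ _) (lsupp_mono _ _)) !big_seq_fset1
  !lcoef_mono !eqxx.
Qed.

Fact lmul_suml (I : Type) (r : seq I) (F : I -> laurent2 R) h :
  lmul (\sum_(i <- r) F i) h = \sum_(i <- r) lmul (F i) h.
Proof. exact: (big_morph (lmul^~ h) (fun g g' => lmulDl g g' h) (lmul0g h)). Qed.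

Fact lmul_sumr (I : Type) (r : seq I) (F : I -> laurent2 R) h :
  lmul h (\sum_(i <- r) F i) = \sum_(i <- r) lmul h (F i).
Proof. exact: (big_morph (lmul h) (lmulDr h) (lmulg0 h)). Qed.

Fact lmulA : associative lmul.
Proof.
move=> x y z; rewrite [x]laurentE !lmul_suml; apply: eq_bigr => k _.
rewrite [y]laurentE lmul_suml !lmul_sumr lmul_suml; apply: eq_bigr => l _.
rewrite [z]laurentE !lmul_sumr; apply: eq_bigr => n _.
by rewrite !lmulUU mulrA addrA.
Qed.

Fact lmul1g : left_id lone lmul.
Proof.
move=> g; rewrite [g]laurentE lmul_sumr; apply: eq_bigr => k _.
by rewrite lmulUU mul1r add0r.
Qed.

Fact lone_neq0 : lone != 0.
Proof.
apply/eqP => /laurentP/(_ 0)/eqP.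
by rewrite lcoef_mono lcoef0 eqxx oner_eq0.
Qed.

HB.instance Definition _ :=
  GRing.Zmodule_isComNzRing.Build (laurent2 R) lmulA lmulC lmul1g lmulDl lone_neq0.

Lemma lmonoM c c' k l : lmono c k * lmono c' l = lmono (c * c') (k + l).
Proof. exact: lmulUU. Qed.

Definition lscale c g : laurent2 R := lmono c 0 * g.

Fact lscaleA c1 c2 g : lscale c1 (lscale c2 g) = lscale (c1 * c2) g.
Proof. by rewrite /lscale mulrA lmonoM addr0. Qed.
Fact lscale1 : left_id 1 lscale.
Proof. exact: mul1r. Qed.
Fact lscaleDr : right_distributive lscale +%R.
Proof. by move=> c g h; rewrite /lscale mulrDr. Qed.
Fact lscaleDl g : {morph lscale^~ g : c c' / c + c'}.
Proof. by move=> c c'; rewrite /lscale lmonoD mulrDl. Qed.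

HB.instance Definition _ :=
  GRing.Zmodule_isLmodule.Build R (laurent2 R) lscaleA lscale1 lscaleDr lscaleDl.

Definition lX : laurent2 R := lmono 1 (1, 0).
Definition lXV : laurent2 R := lmono 1 (- 1, 0).
Definition lY : laurent2 R := lmono 1 (0, 1).
Definition lYV : laurent2 R := lmono 1 (0, - 1).

Lemma lXXV : lX * lXV = 1. Proof. by rewrite lmonoM mulr1. Qed.
Lemma lYYV : lY * lYV = 1. Proof. by rewrite lmonoM mulr1. Qed.

(* The sum of [g]_(a, b + s) over all integers b divisible by M; only finitely
   many terms are nonzero, so the finitely supported sum is the actual sum. *)
Definition sum_coef_dvd (M : nat) g (a s : int) : R :=
  \sum_(b \in [set b : int | (M %| b)%Z]) lcoef g (a, b + s).

End LaurentRing.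

Section Objective.
Variables (R : realType) (m M : nat).
Implicit Type P : 'M[R]_(m.+1, M).

(* f(x, y) for Laurent polynomials x and y, so that both f(X, Y) and
   f(X^-1, Y^-1) are instances. *)
Definition fpoly P (x y : laurent2 R) : laurent2 R :=
  \sum_(i < m.+1) \sum_(j < M) P i j *: (x ^+ i * y ^+ j).

Definition P6 P : R :=
  sum_coef_dvd M (fpoly P (lX R) (lY R) ^+ 3 * fpoly P (lXV R) (lYV R) ^+ 3) 0 0.

Definition feasible (pstar : 'I_m.+1 -> R) : set 'M[R]_(m.+1, M) :=
  [set P | (forall i j, 0 <= P i j <= 1) /\
           forall i, \sum_(j < M) P i j = pstar i].

End Objective.

Definition local_min_on (R : realType) (T : topologicalType) (A : set T)
    (F : T -> R) (x : T) : Prop :=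
  A x /\ \forall y \near within A (nbhs x), F x <= F y.

(* Main.v *)
(* Reduce Laurent polynomials modulo Y^M - 1.  There P6 becomes the squared l2
   norm of f^3 in the group algebra of Z x Z/M.  Let u be the polynomial of the
   matrix U with constant rows pstar_i / M, and h = f - u.  Since u is a
   multiple of 1 + Y + ... + Y^(M-1) and the rows of P - U sum to 0, the
   products of u with h and with its conjugate vanish, so that
   |(u + s h)^3|^2 = |u^3|^2 + s^6 |h^3|^2.  Moving from P (s = 1) towards U,
   which stays feasible even when P is on the boundary, local minimality forces
   h^3 = 0.  Hence f^3 f'^2 = u^3 u'^2, which is invariant under
   multiplication by Y. *)
Require Import Defs.
From mathcomp Require Import all_boot all_order all_algebra finmap.
From mathcomp Require Import boolp classical_sets functions fsbigop.
From mathcomp Require Import reals topology normedtype.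
From mathcomp Require Import ring lra.
Set Implicit Arguments.
Unset Strict Implicit.
Unset Printing Implicit Defensive.
Import Order.TTheory GRing.Theory Num.Theory.
Import numFieldNormedType.Exports.
Local Open Scope ring_scope.

(** * Coefficient sums over residue classes of the exponent of Y *)

Section LaurentModulo.
Context {R : comNzRingType}.
Implicit Types (g h : laurent2 R) (k : int * int) (c : R).

(** An exponent [k] with [k.1 = a] is met by exactly one [b], namely [k.2 - s]. The set [D] is left
    free so that several polynomials can be summed over a common index set. *)
Lemma sum_coef_dvdE (M : nat) g (D : {fset int * int}) (a s : int) :
  (lsupp g `<=` D)%fset ->
  sum_coef_dvd M g a s =
    \sum_(k <- D) if (k.1 == a) && (M %| k.2 - s)%Z then lcoef g k else 0.
Proof.
move=> gD; rewrite /sum_coef_dvd fsbig_mkcond.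
pose B := [fset k.2 - s | k in D]%fset.
rewrite (fsbigTE B); last first.
  move=> b bB; rewrite /patch; case: ifP => // _; apply: lcoef_out.
  apply: contra bB => /(fsubsetP gD) abD; apply/imfsetP.
  by exists (a, b + s) => //=; rewrite addrK.
transitivity (\sum_(b <- B) \sum_(k <- D)
    if (k == (a, b + s)) && (M %| b)%Z then lcoef g k else 0).
  apply: eq_bigr => b _; rewrite /patch.
  rewrite (_ : (b \in _) = (M %| b)%Z); last by rewrite mem_setE.
  have [Mb|Mb] := boolP (M %| b)%Z; last first.
    by rewrite big1 // => k _; rewrite andbF.
  under eq_bigr do rewrite andbT.
  have [abD|abD] := boolP ((a, b + s) \in D).
    rewrite (big_fsetD1 (a, b + s)) //= eqxx big1_fset ?addr0 // => k.
    by rewrite !inE => /andP[/negPf ->].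
  rewrite big_seq big1.
    by rewrite lcoef_out //; apply: contra abD => /(fsubsetP gD).
  by move=> k kD; case: eqP kD abD => // -> ->.
rewrite exchange_big /= [LHS]big_seq [RHS]big_seq; apply: eq_bigr => k kD.
have kB : k.2 - s \in B by apply/imfsetP; exists k.
rewrite (big_fsetD1 (k.2 - s)) //= big1_fset ?addr0 => [|b].
  by rewrite subrK; case: k {kD kB} => k1 k2; rewrite xpair_eqE /= eqxx andbT.
rewrite !inE => /andP[bk _] _; case: ifP => // /andP[/eqP kE _].
by rewrite kE addrK eqxx in bk.
Qed.

Lemma sum_coef_dvdD (M : nat) g h (a s : int) :
  sum_coef_dvd M (g + h) a s = sum_coef_dvd M g a s + sum_coef_dvd M h a s.
Proof.
rewrite (@sum_coef_dvdE _ _ (lsupp g `|` lsupp h)%fset); last exact: lsuppD.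
rewrite (@sum_coef_dvdE _ g (lsupp g `|` lsupp h)%fset); last exact: fsubsetUl.
rewrite (@sum_coef_dvdE _ h (lsupp g `|` lsupp h)%fset); last exact: fsubsetUr.
rewrite -big_split; apply: eq_bigr => k _ /=.
by case: ifP; rewrite ?lcoefD ?addr0.
Qed.

Lemma sum_coef_dvd_mono (M : nat) c k (a s : int) :
  sum_coef_dvd M (lmono c k) a s =
    if (k.1 == a) && (M %| k.2 - s)%Z then c else 0.
Proof.
rewrite (@sum_coef_dvdE _ _ [fset k]%fset) ?lsupp_mono //.
by rewrite big_seq_fset1 lcoef_mono eqxx.
Qed.

Lemma sum_coef_dvd0 (M : nat) (a s : int) :
  sum_coef_dvd M (0 : laurent2 R) a s = 0.
Proof. by rewrite -(lmono0 R 0) sum_coef_dvd_mono if_same. Qed.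

Lemma sum_coef_dvdN (M : nat) g (a s : int) :
  sum_coef_dvd M (- g) a s = - sum_coef_dvd M g a s.
Proof.
by apply/eqP; rewrite -addr_eq0 -sum_coef_dvdD addNr sum_coef_dvd0.
Qed.

Lemma sum_coef_dvd_sum (M : nat) (I : Type) (r : seq I)
    (F : I -> laurent2 R) (a s : int) :
  sum_coef_dvd M (\sum_(i <- r) F i) a s =
  \sum_(i <- r) sum_coef_dvd M (F i) a s.
Proof.
apply: (big_morph (fun g => sum_coef_dvd M g a s)).
  by move=> g h; exact: sum_coef_dvdD.
exact: sum_coef_dvd0.
Qed.

Lemma lscaleE c g : c *: g = lmono c 0 * g.
Proof. by []. Qed.

Lemma sum_coef_dvd_mulmono (M : nat) c k g (a s : int) :
  sum_coef_dvd M (lmono c k * g) a s =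
    c * sum_coef_dvd M g (a - k.1) (s - k.2).
Proof.
rewrite [g]laurentE mulr_sumr !sum_coef_dvd_sum mulr_sumr.
apply: eq_bigr => l _; rewrite lmonoM !sum_coef_dvd_mono /=.
have -> : l.2 - (s - k.2) = k.2 + l.2 - s by ring.
rewrite [k.1 + _]addrC -subr_eq0 -[l.1 == _]subr_eq0 opprB addrA.
by case: ifP; rewrite ?mulr0.
Qed.

Lemma sum_coef_dvdZ (M : nat) c g (a s : int) :
  sum_coef_dvd M (c *: g) a s = c * sum_coef_dvd M g a s.
Proof. by rewrite [LHS](sum_coef_dvd_mulmono _ _ 0) !subr0. Qed.

(* The ideal generated by [Y ^+ M - 1]. *)
Definition mod_zero (M : nat) g := forall a s, sum_coef_dvd M g a s = 0.

Lemma mod_zeroD (M : nat) g h :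
  mod_zero M g -> mod_zero M h -> mod_zero M (g + h).
Proof. by move=> g0 h0 a s; rewrite sum_coef_dvdD g0 h0 addr0. Qed.

Lemma mod_zero_sum (M : nat) (I : Type) (r : seq I) (F : I -> laurent2 R) :
  (forall i, mod_zero M (F i)) -> mod_zero M (\sum_(i <- r) F i).
Proof.
by move=> F0 a s; rewrite sum_coef_dvd_sum big1 // => i _; exact: F0.
Qed.

Lemma mod_zeroMl (M : nat) g h : mod_zero M h -> mod_zero M (g * h).
Proof.
move=> h0; rewrite [g]laurentE mulr_suml; apply: mod_zero_sum => k a s.
by rewrite sum_coef_dvd_mulmono h0 mulr0.
Qed.

Lemma mod_zeroMr (M : nat) g h : mod_zero M g -> mod_zero M (g * h).
Proof. by rewrite mulrC; exact: mod_zeroMl. Qed.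

Lemma sum_coef_dvd_eq (M : nat) g h (a s : int) :
  mod_zero M (g - h) -> sum_coef_dvd M g a s = sum_coef_dvd M h a s.
Proof.
move=> /(_ a s)/eqP; rewrite sum_coef_dvdD sum_coef_dvdN subr_eq0.
by move/eqP.
Qed.

Lemma mod_zero_mono (M : nat) c k l :
  k.1 = l.1 -> (M %| k.2 - l.2)%Z -> mod_zero M (lmono c k - lmono c l).
Proof.
move=> kl1 kl2 a s; rewrite sum_coef_dvdD sum_coef_dvdN !sum_coef_dvd_mono kl1.
have -> : k.2 - s = (k.2 - l.2) + (l.2 - s) by rewrite addrA subrK.
by rewrite rpredDl // subrr.
Qed.

Lemma lmonoX c k n : lmono c k ^+ n = lmono (c ^+ n) (k *+ n).
Proof.
elim: n => [|n IHn]; first by rewrite !expr0 mulr0n.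
by rewrite !exprS mulrS IHn lmonoM.
Qed.

(** * The involution inverting X and Y *)

Definition lconj g : laurent2 R := \sum_(k <- lsupp g) lmono (lcoef g k) (- k).

Lemma lcoef_conj g k : lcoef (lconj g) k = lcoef g (- k).
Proof.
rewrite [in RHS](laurentE g) !lcoef_sum; apply: eq_bigr => l _.
by rewrite !lcoef_mono eqr_oppLR.
Qed.

Lemma lconjD : {morph lconj : g h / g + h}.
Proof.
by move=> g h; apply/laurentP => k; rewrite lcoefD !lcoef_conj lcoefD.
Qed.

Lemma lconj_mono c k : lconj (lmono c k) = lmono c (- k).
Proof.
by apply/laurentP => l; rewrite lcoef_conj !lcoef_mono eqr_oppLR.
Qed.

Lemma lconj_sum (I : Type) (r : seq I) (F : I -> laurent2 R) :
  lconj (\sum_(i <- r) F i) = \sum_(i <- r) lconj (F i).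
Proof.
apply: (big_morph lconj lconjD).
by rewrite -(lmono0 R 0) lconj_mono oppr0.
Qed.

Lemma lconjM : {morph lconj : g h / g * h}.
Proof.
move=> g h; rewrite [g]laurentE [h]laurentE mulr_suml !lconj_sum mulr_suml.
apply: eq_bigr => k _; rewrite !mulr_sumr lconj_sum; apply: eq_bigr => l _.
by rewrite lmonoM !lconj_mono lmonoM opprD.
Qed.

Lemma lconjX g n : lconj (g ^+ n) = lconj g ^+ n.
Proof.
elim: n => [|n IHn]; first by rewrite !expr0 [LHS]lconj_mono oppr0.
by rewrite !exprS lconjM IHn.
Qed.

Lemma lconjZ c g : lconj (c *: g) = c *: lconj g.
Proof. by rewrite !lscaleE lconjM lconj_mono oppr0. Qed.

Lemma lconj_lX : lconj (lX R) = lXV R.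
Proof. exact: lconj_mono. Qed.

Lemma lconj_lY : lconj (lY R) = lYV R.
Proof. exact: lconj_mono. Qed.

Lemma sum_coef_dvd_conj (M : nat) g (a s : int) :
  sum_coef_dvd M (lconj g) a s = sum_coef_dvd M g (- a) (- s).
Proof.
rewrite [in RHS](laurentE g) !sum_coef_dvd_sum; apply: eq_bigr => k _.
by rewrite !sum_coef_dvd_mono /= eqr_oppLR -opprD rpredN opprK.
Qed.


(** * Vanishing of mixed products modulo Y^M - 1 *)

Lemma mod_zero_geometric (M : nat) (y : laurent2 R) :
  y \in [:: lY R; lYV R] ->
  mod_zero M ((\sum_(j < M) y ^+ j) * (lY R - 1)) /\
  mod_zero M ((\sum_(j < M) y ^+ j) * (lYV R - 1)).
Proof.
set N := \sum_(j < M) _ => yY.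
(* Telescoping turns the product into y^M - 1, a difference of two monomials whose Y-exponents are
   congruent modulo M. *)
have N0 : mod_zero M (N * (y - 1)).
  rewrite mulrC -subrX1.
  have [c ->] : exists b : int, y = lmono 1 (0, b).
    by move: yY; rewrite !inE => /orP[] /eqP ->; eexists.
  rewrite lmonoX expr1n; apply: mod_zero_mono => /=.
    by rewrite (raddfMn fst) mul0rn.
  by rewrite (raddfMn snd) subr0 -mulr_natr dvdz_mull // pmulrn intz.
(* As Y is a unit, Y - 1 and Y^-1 - 1 are associates, so killing one of them kills the other. *)
have YYV := lYYV R.
move: yY; rewrite !inE => /orP[] /eqP yE; rewrite yE in N0.
  split; first exact: N0.
  have -> : N * (lYV R - 1) = - lYV R * (N * (lY R - 1)) by ring: YYV.
  exact: mod_zeroMl.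
split; last exact: N0.
have -> : N * (lY R - 1) = - lY R * (N * (lYV R - 1)) by ring: YYV.
exact: mod_zeroMl.
Qed.

Lemma mod_zeroM_exprB (M : nat) (w x y : laurent2 R) n :
  mod_zero M (w * (x - y)) -> mod_zero M (w * (x ^+ n - y ^+ n)).
Proof. by move=> wxy; rewrite subrXX mulrA; exact: mod_zeroMr. Qed.

(** The positive exponent [m.+1] puts an unprimed [u] or [v] in every term of the expansion, so each
    mixed term contains [u * v], [u * v'] or [v * u']. The four summands below arise by splitting
    off one such factor and replacing the remaining powers one at a time. *)
Lemma mod_zero_exprDM (M : nat) (u v u' v' : laurent2 R) m n :
  mod_zero M (u * v) -> mod_zero M (u * v') -> mod_zero M (v * u') ->
  mod_zero M ((u + v) ^+ m.+1 * (u' + v') ^+ n -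
              (u ^+ m.+1 * u' ^+ n + v ^+ m.+1 * v' ^+ n)).
Proof.
move=> uv uv' vu'.
have -> : (u + v) ^+ m.+1 * (u' + v') ^+ n -
          (u ^+ m.+1 * u' ^+ n + v ^+ m.+1 * v' ^+ n) =
    (u' + v') ^+ n * (u * ((u + v) ^+ m - u ^+ m)) +
    (u' + v') ^+ n * (v * ((u + v) ^+ m - v ^+ m)) +
    (u ^+ m * (u * ((u' + v') ^+ n - u' ^+ n)) +
     v ^+ m * (v * ((u' + v') ^+ n - v' ^+ n))).
  by rewrite !exprS; ring.
by apply: mod_zeroD; apply: mod_zeroD; apply: mod_zeroMl;
  apply: mod_zeroM_exprB;
  rewrite ?addrK ?[_ + _ - _]addrAC ?subrr ?add0r // mulrC.
Qed.

Lemma sum_coef_dvd_exprDM (M : nat) (u h u' h' : laurent2 R) c m n (a s : int) :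
  mod_zero M (u * h) -> mod_zero M (u * h') -> mod_zero M (h * u') ->
  sum_coef_dvd M ((u + c *: h) ^+ m.+1 * (u' + c *: h') ^+ n) a s =
  sum_coef_dvd M (u ^+ m.+1 * u' ^+ n) a s +
  c ^+ (m.+1 + n) * sum_coef_dvd M (h ^+ m.+1 * h' ^+ n) a s.
Proof.
move=> uh uh' hu'; rewrite !lscaleE.
rewrite (@sum_coef_dvd_eq M _ (u ^+ m.+1 * u' ^+ n +
  (lmono c 0 * h) ^+ m.+1 * (lmono c 0 * h') ^+ n)); last first.
  apply: mod_zero_exprDM; first by rewrite mulrCA; exact: mod_zeroMl.
    by rewrite mulrCA; exact: mod_zeroMl.
  by rewrite -mulrA; exact: mod_zeroMl.
rewrite sum_coef_dvdD; congr (_ + _).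
rewrite !exprMn mulrACA -exprD lmonoX mul0rn -lscaleE.
exact: sum_coef_dvdZ.
Qed.

(** The hypothesis says that Y acts trivially on [u], hence on every multiple [w] of [u];
    multiplying [w] by Y^j moves the residue class of 0 to that of [j]. *)
Lemma sum_coef_dvd_shift (M : nat) (u v : laurent2 R) (n : nat) (a : int)
    (j : nat) :
  mod_zero M (u * (lY R - 1)) ->
  sum_coef_dvd M (u ^+ n.+1 * v) a j = sum_coef_dvd M (u ^+ n.+1 * v) a 0.
Proof.
move=> uY; set w := u ^+ n.+1 * v.
have /sum_coef_dvd_eq <- : mod_zero M (lY R ^+ j * w - w).
  have -> : lY R ^+ j * w - w = u ^+ n * v * (u * (lY R ^+ j - 1 ^+ j)).
    by rewrite /w exprSr expr1n; ring.
  by apply: mod_zeroMl; exact: mod_zeroM_exprB.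
rewrite lmonoX expr1n sum_coef_dvd_mulmono mul1r (raddfMn fst) (raddfMn snd) /=.
by rewrite mul0rn subr0 pmulrn intz subrr.
Qed.

(** * Reduced representatives and the squared l2 norm *)

Lemma sum_coef_dvd_reduced (M : nat) g (a s : int) :
  (forall k, k \in lsupp g -> 0 <= k.2 < M%:Z) -> 0 <= s < M%:Z ->
  sum_coef_dvd M g a s = lcoef g (a, s).
Proof.
move=> gM sM; rewrite (sum_coef_dvdE _ _ _ (fsubset_refl _)).
rewrite [in RHS](laurentE g) lcoef_sum [LHS]big_seq [RHS]big_seq.
apply: eq_bigr => -[k1 k2] kg; rewrite lcoef_mono xpair_eqE /= [a == _]eq_sym.
congr (if _ && _ then _ else _).
(* Both [k2] and [s] lie in [0, M), so congruence modulo M is equality. *)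
rewrite -eqz_mod_dvd !modz_small ?gtz0_abs //; last exact: (gM _ kg).
Qed.

Lemma mod_zero_reduced_exists (M : nat) g : (0 < M)%N ->
  exists2 g0, mod_zero M (g - g0) & forall k, k \in lsupp g0 -> 0 <= k.2 < M%:Z.
Proof.
move=> M0.
exists (\sum_(k <- lsupp g) lmono (lcoef g k) (k.1, (k.2 %% M)%Z)).
  rewrite [X in X - _]laurentE -sumrB; apply: mod_zero_sum => k.
  apply: mod_zero_mono => //=.
  by rewrite -eqz_mod_dvd modz_mod.
move=> k; apply: contraLR => kM; rewrite memNfinsupp; apply/eqP.
rewrite -[LHS]/(lcoef _ k) lcoef_sum big1 // => l _; rewrite lcoef_mono.
case: eqP => // kE; move: kM; rewrite kE /= modz_ge0 ?ltz_pmod //.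
by rewrite lt0n_neq0.
Qed.

End LaurentModulo.

(* [g0] is the representative of [g] with exponents of Y in [0, M), so its
   coefficients are those of the image of [g] in the group algebra of Z x Z/M. *)
Lemma sum_coef_dvd_conj_sqr (R : comNzRingType) (M : nat) (g : laurent2 R) :
  (0 < M)%N ->
  exists2 g0, mod_zero M (g - g0) &
    sum_coef_dvd M (g * lconj g) 0 0 = \sum_(k <- lsupp g0) lcoef g0 k ^+ 2.
Proof.
move=> M0; have [g0 gg0 g0M] := mod_zero_reduced_exists g M0.
exists g0 => //.
(* Only the left factor is reduced: its monomial at [k] extracts from [lconj g] the class sum of [g]
   at [k], which is again the coefficient of [g0] at [k]. *)
rewrite (@sum_coef_dvd_eq _ _ _ (g0 * lconj g)); last first.
  by rewrite -mulrBl; exact: mod_zeroMr.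
rewrite [in LHS](laurentE g0) mulr_suml sum_coef_dvd_sum.
rewrite [LHS]big_seq [RHS]big_seq; apply: eq_bigr => -[a s] kg0.
rewrite sum_coef_dvd_mulmono sum_coef_dvd_conj /= !sub0r !opprK expr2.
rewrite (sum_coef_dvd_eq _ _ gg0).
by rewrite sum_coef_dvd_reduced //; exact: (g0M _ kg0).
Qed.

Lemma sum_coef_dvd_conj_ge0 (R : realDomainType) (M : nat) (g : laurent2 R) :
  (0 < M)%N -> 0 <= sum_coef_dvd M (g * lconj g) 0 0.
Proof.
move=> M0; have [g0 _ ->] := sum_coef_dvd_conj_sqr g M0.
by apply: sumr_ge0 => k _; exact: sqr_ge0.
Qed.

(** Definiteness of the norm: a vanishing sum of squares forces all coefficients of the reduced
    representative to vanish. *)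
Lemma sum_coef_dvd_conj_eq0 (R : realDomainType) (M : nat) (g : laurent2 R) :
  (0 < M)%N -> sum_coef_dvd M (g * lconj g) 0 0 = 0 -> mod_zero M g.
Proof.
move=> M0; have [g0 gg0 ->] := sum_coef_dvd_conj_sqr g M0.
move/eqP; rewrite psumr_eq0 => [/allP g00|k _]; last exact: sqr_ge0.
suff g0E : g0 = 0 by rewrite g0E subr0 in gg0.
rewrite [g0]laurentE big_seq big1 // => k /g00 /=.
by rewrite sqrf_eq0 => /eqP ->; exact: lmono0.
Qed.

(** * Polynomials attached to matrices *)

Section Generating.
Context {R : realType} {m M : nat}.
Implicit Types (P H : 'M[R]_(m.+1, M)) (w x y : laurent2 R).

Lemma fpolyD P H x y : fpoly (P + H) x y = fpoly P x y + fpoly H x y.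
Proof.
rewrite /fpoly -big_split; apply: eq_bigr => i _; rewrite -big_split.
by apply: eq_bigr => j _; rewrite mxE scalerDl.
Qed.

Lemma fpolyZ c P x y : fpoly (c *: P) x y = c *: fpoly P x y.
Proof.
rewrite /fpoly scaler_sumr; apply: eq_bigr => i _; rewrite scaler_sumr.
by apply: eq_bigr => j _; rewrite mxE scalerA.
Qed.

Lemma lconj_fpoly P : lconj (fpoly P (lX R) (lY R)) = fpoly P (lXV R) (lYV R).
Proof.
rewrite /fpoly lconj_sum; apply: eq_bigr => i _; rewrite lconj_sum.
apply: eq_bigr => j _.
by rewrite lconjZ lconjM !lconjX lconj_lX lconj_lY.
Qed.

(** Zero row sums allow each y^j to be replaced by y^j - 1, a multiple of y - 1, which [w]
    annihilates. *)
Lemma mod_zeroM_fpoly H w x y : (forall i, \sum_j H i j = 0) ->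
  mod_zero M (w * (y - 1)) -> mod_zero M (w * fpoly H x y).
Proof.
move=> H0 wy; rewrite /fpoly mulr_sumr; apply: mod_zero_sum => i.
have -> : \sum_(j < M) H i j *: (x ^+ i * y ^+ j) =
          \sum_(j < M) H i j *: (x ^+ i * (y ^+ j - 1 ^+ j)).
  transitivity (\sum_(j < M) H i j *: (x ^+ i * y ^+ j) -
                (\sum_j H i j) *: x ^+ i); first by rewrite H0 scale0r subr0.
  rewrite scaler_suml -sumrB; apply: eq_bigr => j _.
  by rewrite expr1n mulrBr mulr1 scalerBr.
rewrite mulr_sumr; apply: mod_zero_sum => j.
rewrite lscaleE [X in w * X]mulrA mulrCA.
by apply: mod_zeroMl; exact: mod_zeroM_exprB.
Qed.

Definition row_const_mx (q : 'I_m.+1 -> R) :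
  'M[R]_(m.+1, M) := \matrix_(i, j) q i.

Lemma fpoly_row_const (q : 'I_m.+1 -> R) x y :
  fpoly (row_const_mx q) x y =
  (\sum_(i < m.+1) q i *: x ^+ i) * \sum_(j < M) y ^+ j.
Proof.
rewrite /fpoly mulr_suml; apply: eq_bigr => i _; rewrite mulr_sumr.
by apply: eq_bigr => j _; rewrite mxE !lscaleE mulrA.
Qed.

Lemma mod_zero_row_const (q : 'I_m.+1 -> R) x y :
  y \in [:: lY R; lYV R] ->
  mod_zero M (fpoly (row_const_mx q) x y * (lY R - 1)) /\
  mod_zero M (fpoly (row_const_mx q) x y * (lYV R - 1)).
Proof.
move=> /(mod_zero_geometric M)[N1 N2]; rewrite fpoly_row_const -!mulrA.
by split; exact: mod_zeroMl.
Qed.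

(** Stated for general exponents to serve twice: with 3 and 3 for the objective along the segment,
    and with 3 and 2 for the stationarity condition. *)
Lemma sum_coef_dvd_fpolyD (q : 'I_m.+1 -> R) H (c : R) (k n : nat) (a s : int) :
  (forall i, \sum_j H i j = 0) ->
  let f P := fpoly P (lX R) (lY R) in let f' P := fpoly P (lXV R) (lYV R) in
  let U := row_const_mx q in
  sum_coef_dvd M (f (U + c *: H) ^+ k.+1 * f' (U + c *: H) ^+ n) a s =
  sum_coef_dvd M (f U ^+ k.+1 * f' U ^+ n) a s +
  c ^+ (k.+1 + n) * sum_coef_dvd M (f H ^+ k.+1 * f' H ^+ n) a s.
Proof.
move=> H0 /=.
(* Annihilation of Y - 1 yields [u * h] and [u' * h]; annihilation of Y^-1 - 1 yields [u * h']. *)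
have [uY uYV] := mod_zero_row_const q (lX R) (mem_head (lY R) _).
have [u'Y _] := mod_zero_row_const q (lXV R) (mem_last (lY R) [:: lYV R]).
have uh := mod_zeroM_fpoly (lX R) H0 uY.
have uh' := mod_zeroM_fpoly (lXV R) H0 uYV.
have hu' := mod_zeroM_fpoly (lX R) H0 u'Y; rewrite mulrC in hu'.
rewrite !fpolyD !fpolyZ.
exact: (sum_coef_dvd_exprDM c k n a s uh uh' hu').
Qed.

End Generating.

(** * Moving from the minimizer towards the matrix with constant rows *)

Lemma cvg_segment_mx (R : realType) (m n : nat) (A B : 'M[R]_(m.+1, n))
    (t0 : R) :
  ((A + (1 - t) *: B) @[t --> t0] --> A + (1 - t0) *: B)%classic.
Proof.
(* With no columns all matrices coincide and the map is constant; otherwise the matrices form a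
   normed module and the limit is taken termwise. *)
case: n A B => [|n] A B.
  rewrite (_ : (fun t => _) = fun=> A + (1 - t0) *: B); first exact: cvg_cst.
  by apply/funext => t; rewrite !thinmx0.
apply: cvgD; first exact: cvg_cst.
apply: cvgZr_tmp; apply: cvgB; first exact: cvg_cst.
exact: cvg_id.
Qed.

Theorem lemma1 (R : realType) (m M : nat) (hm : (1 <= m)%N) (hM : (2 <= M)%N)
  (pstar : 'I_m.+1 -> R) (pstar_ge0 : forall i, 0 <= pstar i)
  (pstar_sum : \sum_(i < m.+1) pstar i = 1)
  (P : 'M[R]_(m.+1, M)) (Pmin : local_min_on (feasible pstar) (@P6 R m M) P) :
  exists c : 'I_m.+1 -> R, forall (i : 'I_m.+1) (j : 'I_M),
    sum_coef_dvd M
      (fpoly P (lX R) (lY R) ^+ 3 * fpoly P (lXV R) (lYV R) ^+ 2)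
      (i : nat)%:Z (j : nat)%:Z = c i.
Proof.
have M0 : (0 < M)%N by exact: ltnW.
have MR0 : 0 < M%:R :> R by rewrite ltr0n.
have [[P01 Psum] Pnear] := Pmin.
pose q i := pstar i / M%:R.
pose U : 'M[R]_(m.+1, M) := row_const_mx q; pose H := P - U.
have Usum i : \sum_j U i j = pstar i.
  under eq_bigr do rewrite mxE.
  by rewrite sumr_const card_ord -mulr_natr divfK // gt_eqF.
have H0 i : \sum_j H i j = 0.
  transitivity (\sum_j P i j - \sum_j U i j); last by rewrite Psum Usum subrr.
  by rewrite -sumrB; apply: eq_bigr => j _; rewrite !mxE.
(* The parameter t is 1 - s, so that [F 0] is [P], [F 1] is [U], and the minimizer is approached as
   t tends to 0 from the right. *)
pose F (t : R) := U + (1 - t) *: H.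
have F0 : F 0 = P by rewrite /F subr0 scale1r addrC subrK.
have pstar_le1 i : pstar i <= 1.
  by rewrite -pstar_sum (bigD1 i) //= lerDl sumr_ge0.
have U01 i j : 0 <= U i j <= 1.
  rewrite mxE /q; apply/andP; split; first exact: divr_ge0.
  by rewrite ler_pdivrMr // mul1r (le_trans (pstar_le1 i)) // ler1n.
have Ffeas t : 0 <= t <= 1 -> feasible pstar (F t).
  move=> t01; split=> [i j|i].
    (* Each entry of [F t] is the convex combination t U + (1 - t) P. *)
    by move: (P01 i j) (U01 i j); rewrite /F /H !mxE; nra.
  under eq_bigr do rewrite mxE [X in _ + X]mxE.
  by rewrite big_split /= -mulr_sumr H0 mulr0 addr0 Usum.
have Fcvg : (F t @[t --> (0 : R)] --> P)%classic.
  by rewrite -F0 /F; exact: cvg_segment_mx.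
have [t /andP[t0 t1] Pt] : exists2 t : R, 0 < t < 1 & P6 P <= P6 (F t).
  (* Right neighbourhoods keep t positive, which makes (1 - t)^6 < 1 strict later on. Feasibility
     stays a premise here and is discharged by [Ffeas]. *)
  have near0 : \forall t \near (0 : R)^'+%classic,
      feasible pstar (F t) -> P6 P <= P6 (F t).
    by apply: cvg_within; exact: (Fcvg _ Pnear).
  near (0 : R)^'+%classic => t.
  have t01 : 0 < t < 1 by apply/andP; split; near: t;
    [exact: nbhs_right_gt|exact: nbhs_right_lt].
  exists t; first exact: t01.
  have Ft : feasible pstar (F t).
    by apply: Ffeas; case/andP: t01 => /ltW -> /ltW.
  by move: Ft; near: t.
pose h := fpoly H (lX R) (lY R).
have P6F s :
    P6 (F s) =
    P6 U + (1 - s) ^+ 6 * sum_coef_dvd M (h ^+ 3 * lconj (h ^+ 3)) 0 0.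
  rewrite lconjX lconj_fpoly.
  exact: (sum_coef_dvd_fpolyD q (1 - s) 2 3 0 0 H0).
have B_ge0 := sum_coef_dvd_conj_ge0 (h ^+ 3) M0.
have h3_0 : mod_zero M (h ^+ 3).
  apply: sum_coef_dvd_conj_eq0 => //; apply/le_anti; rewrite B_ge0 andbT.
  (* With B the squared norm of h^3, minimality reads B <= (1 - t)^6 B, while (1 - t)^6 < 1; hence B
     <= 0. *)
  move: Pt; rewrite -F0 !P6F subr0 expr1n mul1r lerD2l.
  have : (1 - t) ^+ 6 < 1 by rewrite exprn_ilt1 //; lra.
  by move: B_ge0; nra.
(* The constant is the value for [U] at j = 0; Y-invariance of the polynomial of [U] makes it the
   value at every j. *)
exists (fun i => sum_coef_dvd M
  (fpoly U (lX R) (lY R) ^+ 3 * fpoly U (lXV R) (lYV R) ^+ 2) i 0).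
(* Here [P] is [U + 1 *: H], and the term from [H] contains the factor h^3. *)
move=> i j; rewrite -[P]F0 /F subr0 (sum_coef_dvd_fpolyD q 1 2 2 _ _ H0).
rewrite [X in _ + _ * X](mod_zeroMr _ h3_0) mulr0 addr0.
have [uY _] := @mod_zero_row_const R m M q (lX R) (lY R) (mem_head _ _).
exact: (sum_coef_dvd_shift _ 2 i j uY).
Unshelve. all: by end_near. Qed.
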